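(* Let $\{X, X_{k,i};\ i \geq 1, k \geq 1\}$ be a double array of i.i.d. real-valued random variables with $\mathbb{E}X^2 = 1$. If, for some constant $0 < a < \infty$, $$n^2\,\mathbb{P}\left( n^{1/4} \frac{|X_{1,1} X_{1,2}|}{\sqrt{\sum_{k=1}^{n} X_{k,1}^2}\,\sqrt{\sum_{k=1}^{n} X_{k,2}^2}} > a \right) = O(1) \quad \text{as } n \to \infty,$$ then $$\mathbb{E}|X|^r < \infty \quad \text{for all } 0 < r < \frac{8}{3}.$$
   Context: A ratio whose denominator vanishes is taken to be $0$. *)

(* Defs.v *)
From HB Require Import structures.
From mathcomp Require Import all_boot all_order all_algebra finmap.
From mathcomp Require Import all_classical all_reals all_analysis.

Set Implicit Arguments.
Unset Strict Implicit.
Unset Printing Implicit Defensive.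

Import Order.TTheory GRing.Theory Num.Theory.
Import numFieldNormedType.Exports.

Local Open Scope classical_set_scope.
Local Open Scope ring_scope.

Definition mutually_independent d (T : measurableType d) (R : realType)
    (P : probability T R) (I : choiceType) (D : set I)
    (Z : I -> {RV P >-> R}) : Prop :=
  forall (J : {fset I}) (B : I -> set R),
    [set` J] `<=` D -> (forall i, i \in J -> measurable (B i)) ->
    P (\bigcap_(i in [set` J]) Z i @^-1` B i) =
      (\prod_(i <- J) P (Z i @^-1` B i))%E.

(* Laws are compared on measurable sets only: the values of a measure on other
   sets are unconstrained, so equality of distributions as functions on all
   sets would be too strong. *)
Definition identically_distributed d (T : measurableType d) (R : realType)
    (P : probability T R) (I : choiceType) (D : set I)
    (Z : I -> {RV P >-> R}) : Prop :=
  forall i j, D i -> D j -> forall B : set R, measurable B ->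
    distribution P (Z i) B = distribution P (Z j) B.

Definition iid d (T : measurableType d) (R : realType)
    (P : probability T R) (I : choiceType) (D : set I)
    (Z : I -> {RV P >-> R}) : Prop :=
  mutually_independent D Z /\ identically_distributed D Z.

(* The family {X, X_{k,i}; k >= 1, i >= 1}: the index None stands for X and
   Some (k, i) for X_{k,i}; the junk entries with k = 0 or i = 0 are left
   unconstrained. *)
Definition iid_double_array d (T : measurableType d) (R : realType)
    (P : probability T R) (X : {RV P >-> R})
    (Xa : nat -> nat -> {RV P >-> R}) : Prop :=
  iid (None |` (Some @` [set ki : nat * nat | (1 <= ki.1)%N /\ (1 <= ki.2)%N]))
      (oapp (fun ki : nat * nat => Xa ki.1 ki.2) X).

(* Main.v *)
(* Let A be the event that |X_{1,1}| and |X_{1,2}| both exceed u, where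
   u^2 = 6 a n^(3/4), and let W be the sum of the X_{k,i}^2 over 2 <= k <= n and
   i = 1, 2. Each such X_{k,i} is independent of A, so the integral of W over A
   is 2 (n - 1) P(A), and by Markov's inequality P(A, W >= 4n) <= P(A) / 2. On
   the rest of A both sums of squares are at most X_{1,i}^2 + 4n, which forces
   the normalized product above a. Hence P(|X| > u)^2 = P(A) is at most twice
   the probability in the hypothesis, i.e. P(|X| > c n^(3/8)) = O(1/n). Along
   n = 2^j this gives the moments of order r < 8/3 by a geometric series. *)

Require Import Defs.
From HB Require Import structures.
From mathcomp Require Import all_boot all_order all_algebra finmap.
From mathcomp Require Import all_classical all_reals all_analysis.
From mathcomp Require Import measurable_realfun ring lra.

Set Implicit Arguments.
Unset Strict Implicit.
Unset Printing Implicit Defensive.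

Import Order.TTheory GRing.Theory Num.Theory.
Import numFieldNormedType.Exports.

Local Open Scope classical_set_scope.
Local Open Scope ring_scope.

(** * Consequences of independence *)

(** The image under [Y] of [P] restricted to [A] is [P A] times the law of [Y]. Pushing both
    integrals forward to the real line therefore leaves only an equality of measures. *)
Lemma ge0_integral_indep_set d (T : measurableType d) (R : realType)
    (P : probability T R) (A : set T) (Y : {RV P >-> R}) (f : R -> \bar R) :
  measurable A ->
  (forall B, measurable B -> P (A `&` Y @^-1` B) = (P A * P (Y @^-1` B))%E) ->
  measurable_fun setT f -> (forall y, 0%E <= f y)%E ->
  (\int[P]_(t in A) f (Y t) = P A * \int[P]_t f (Y t))%E.
Proof.
move=> mA indep mf f0.
have mY : measurable_fun [set: T] Y by [].
have mfY : measurable_fun [set: T] (f \o Y) by exact: measurableT_comp.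
have pA : (0 <= fine (P A))%R by exact: fine_ge0.
rewrite -[P A in RHS]fineK ?fin_num_measure//.
transitivity (\int[mrestr P mA]_t f (Y t))%E.
  rewrite (@ge0_negligible_integral _ _ _ (mrestr P mA) setT (~` A))//.
  - rewrite setDE setTI setCK; apply: eq_measure_integral => B mB BA.
    by rewrite /= /mrestr setIidl.
  - exact: measurableC.
  - by rewrite /= /mrestr classical_sets.setICl measure0.
rewrite -(@ge0_integral_pushforward _ _ _ _ _ Y _ (mrestr P mA) setT f)//.
rewrite -(@ge0_integral_pushforward _ _ _ _ _ Y _ P setT f)//.
rewrite -(@ge0_integral_mscale _ _ _ (pushforward P Y) _ _ (NngNum pA))//.
apply: eq_measure_integral => B mB _ /=.
rewrite /pushforward /mrestr /mscale /= setIC indep// fineK ?fin_num_measure//.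
Qed.

(** The definition is applied to the finite set of the three distinct indices, with [F] assigning to
    each its own Borel set. Taking [setT] for one of the sets recovers independence of a pair. *)
Lemma mutually_independent3 d (T : measurableType d) (R : realType)
    (P : probability T R) (I : choiceType) (D : set I) (Z : I -> {RV P >-> R})
    (i j k : I) (A B C : set R) :
  mutually_independent D Z -> D i -> D j -> D k ->
  i != j -> i != k -> j != k -> measurable A -> measurable B -> measurable C ->
  P (Z i @^-1` A `&` (Z j @^-1` B `&` Z k @^-1` C)) =
    (P (Z i @^-1` A) * (P (Z j @^-1` B) * P (Z k @^-1` C)))%E.
Proof.
move=> indep Di Dj Dk ij ik jk mA mB mC.
pose F l := if l == i then A else if l == j then B else C.
have Fi : F i = A by rewrite /F eqxx.
have Fj : F j = B by rewrite /F eq_sym (negbTE ij) eqxx.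
have Fk : F k = C by rewrite /F eq_sym (negbTE ik) eq_sym (negbTE jk).
have := indep (i |` (j |` [fset k]))%fset F.
rewrite !bigcap_fsetU1 set_fset1 bigcap_set1 Fi Fj Fk.
rewrite big_fsetU1 ?inE ?negb_or ?ij ?ik//=.
rewrite big_fsetU1 ?inE ?jk//= big_seq_fset1 Fi Fj Fk; apply.
- by move=> l /=; rewrite !inE => /or3P[] /eqP ->.
- by move=> l _; rewrite /F; case: ifP => // _; case: ifP.
Qed.

(** * Moments from geometric tail bounds *)

(** With [K j] the [r]-th power of the level [c * b ^+ j], the variable [|X| ^ r] is dominated by
    [K 0] plus the sum of [K j.+1] over the levels [j] that [|X|] exceeds. Integrated termwise, this
    is a geometric series of ratio [b ^ r * s]. *)
Lemma moment_lty_geometric_tail d (T : measurableType d) (R : realType)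
    (P : probability T R) (X : {RV P >-> R}) (c b s C r : R) :
  0 < c -> 1 < b -> 0 < s -> 0 <= C -> 0 < r -> b `^ r * s < 1 ->
  (forall j, P [set t | (c * b ^+ j < `|X t|)%R] <= (C * s ^+ j)%:E)%E ->
  ('E_P[fun t => (`|X t| `^ r)%R] < +oo)%E.
Proof.
move=> c0 b1 s0 C0 r0 gs1 tail; set g := b `^ r in gs1.
have b0 : 0 < b by lra.
have g0 : 0 <= g by exact: powR_ge0.
pose S j := [set t | c * b ^+ j < `|X t|].
have mX : measurable_fun [set: T] X by [].
have mnX : measurable_fun [set: T] (fun t => `|X t|).
  by apply: measurableT_comp => //; exact: normr_measurable.
have mS j : measurable (S j).
  rewrite -[S j]setTI; apply: (measurable_fun_ltr _ mnX) => //.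
pose K j := c `^ r * g ^+ j.
have K0 j : 0 <= K j by rewrite mulr_ge0 ?powR_ge0 ?exprn_ge0.
have KE j : (c * b ^+ j) `^ r = K j.
  rewrite powRM ?exprn_ge0 ?ltW// /K /g -!powR_mulrn ?powR_ge0 ?ltW//.
  by rewrite -!powRrM (mulrC j%:R).
pose f j t := (K j.+1 * \1_(S j) t)%:E.
have mf j : measurable_fun [set: T] (f j).
  have mI : measurable_fun [set: T] (\1_(S j) : T -> R) by exact: measurable_indic.
  rewrite /f; apply/measurable_EFinP; exact: measurable_funM.
have f0 j t : (0 <= f j t)%E by rewrite lee_fin mulr_ge0.
have dom t : ((`|X t| `^ r)%:E <= (K 0%N)%:E + \sum_(0 <= j <oo) f j t)%E.
  have [m Xm minm] : exists2 m, `|X t| <= c * b ^+ m &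
      forall k, `|X t| <= c * b ^+ k -> (m <= k)%N.
    have ex : exists m, `|X t| <= c * b ^+ m.
      (* Bernoulli's inequality, so that the levels are unbounded by the Archimedean property. *)
      have bern m : 1 + (b - 1) *+ m <= b ^+ m.
        elim: m => [|m ih]; first by rewrite mulr0n addr0 expr0.
        apply: (@le_trans _ _ (b * (1 + (b - 1) *+ m))); last first.
          by rewrite exprS ler_pM2l.
        have : 0 <= (b - 1) ^+ 2 * m%:R by rewrite mulr_ge0 ?sqr_ge0.
        by rewrite mulrS -mulr_natr; nra.
      have e0 : 0 < c * (b - 1) by rewrite mulr_gt0 ?subr_gt0.
      have /archi_boundP : 0 <= `|X t| / (c * (b - 1)) by rewrite divr_ge0// ltW.
      set m := Num.bound _; rewrite ltr_pdivrMr// => Xm; exists m.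
      apply/ltW/(lt_le_trans Xm); have := bern m; rewrite -mulr_natr.
      by nra.
    by exists (ex_minn ex); case: ex_minnP.
  have Xr : `|X t| `^ r <= K m.
    by rewrite -KE ge0_ler_powR ?nnegrE// ltW ?mulr_gt0 ?exprn_gt0.
  (* At level zero [K 0] suffices. Otherwise, by minimality, [|X t|] exceeds the preceding level, so
     the term of that index alone already bounds [|X t| ^ r]. *)
  case: m => [|m] in Xm minm Xr *.
    apply: (@le_trans _ _ (K 0%N)%:E); first by rewrite lee_fin.
    by rewrite leeDl//; apply: nneseries_ge0 => k _ _; exact: f0.
  apply: (@le_trans _ _ (K m.+1)%:E); first by rewrite lee_fin.
  apply: (@le_trans _ _ (\sum_(0 <= j <oo) f j t)%E); last by rewrite leeDr// lee_fin.
  apply: le_trans (nneseries_lim_ge m.+1 _) => //.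
  rewrite big_nat_recr//=; apply: (@le_trans _ _ (f m t)); last first.
    by rewrite leeDr// sume_ge0.
  rewrite lee_fin indicE mem_set ?mulr1// /S /= ltNge.
  by apply/negP => /minm; rewrite ltnn.
rewrite unlock; apply: (@le_lt_trans _ _
  (\int[P]_t ((K 0%N)%:E + \sum_(0 <= j <oo) f j t))%E).
  apply: ge0_le_integral => //.
  - apply/measurable_EFinP; exact: (measurableT_comp (measurable_powR _) mnX).
  - apply: emeasurable_funD => //; exact: ge0_emeasurable_sum.
rewrite ge0_integralD//; last 3 first.
- by move=> t _; rewrite lee_fin.
- by move=> t _; exact: nneseries_ge0.
- exact: ge0_emeasurable_sum.
rewrite integral_cst//.
rewrite [X in (_ * X)%E](_ : _ = 1%E) ?mule1; last exact: probability_setT.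
rewrite integral_nneseries//.
apply: lte_add_pinfty; first exact: ltry.
have le_f j : (\int[P]_t f j t <= (C * c `^ r * g * (g * s) ^+ j)%:E)%E.
  under eq_integral do rewrite /f EFinM.
  rewrite ge0_integralZl_EFin//; last first.
    by apply/measurable_EFinP; exact: measurable_indic.
  rewrite integral_indic// setIT.
  apply: (le_trans (lee_wpmul2l _ (tail j))); first by rewrite lee_fin.
  rewrite -EFinM lee_fin /K exprS exprMn le_eqVlt; apply/orP; left; apply/eqP.
  by ring.
apply: (@le_lt_trans _ _ (\sum_(0 <= j <oo) (C * c `^ r * g * (g * s) ^+ j)%:E)%E).
  apply: lee_nneseries => // j _; first by move=> _; exact: integral_ge0.
apply: (@le_lt_trans _ _ (C * c `^ r * g * (1 - g * s)^-1)%:E); last exact: ltry.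
have A0 : 0 <= C * c `^ r * g by rewrite !mulr_ge0 ?powR_ge0.
have q0 : 0 < g * s by rewrite mulr_gt0 ?powR_gt0.
apply: lime_le.
  by apply: is_cvg_nneseries => j _ _; rewrite lee_fin mulr_ge0// exprn_ge0// ltW.
apply: nearW => n; rewrite sumEFin lee_fin.
have := @geometric_le_lim _ n (C * c `^ r * g) (g * s).
by rewrite /series /= gtr0_norm//; apply.
Qed.

(** * The deterministic lower bound for the normalized product *)

(** From [u ^ 2 <= n] and [u < |x|] follows [x ^ 2 + v <= 5 n x ^ 2 / u ^ 2], and likewise for [y].
    Hence the ratio is at least [u ^ 2 / (5 n)], and multiplying by [n ^ (1/4)] gives [6 a / 5 > a];
    any constant above 5 could replace 6. Both roots are positive, so no ratio here has a zero
    denominator. *)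
Lemma self_normalized_product_gt (R : realType) (a u x y v w : R) (n : nat) :
  0 < a -> (0 < n)%N -> 0 < u -> u ^+ 2 = 6 * a * n%:R `^ (3 / 4) ->
  u ^+ 2 <= n%:R -> u < `|x| -> u < `|y| ->
  0 <= v <= 4 * n%:R -> 0 <= w <= 4 * n%:R ->
  a < n%:R `^ (1 / 4) *
    (`|x * y| / (Num.sqrt (x ^+ 2 + v) * Num.sqrt (y ^+ 2 + w))).
Proof.
move=> a0 n0 u0 uE un ux uy /andP[v0 vn] /andP[w0 wn].
have N0 : 0 < n%:R :> R by rewrite ltr0n.
set p := n%:R `^ (1 / 4); set q := n%:R `^ (3 / 4) in uE.
have p0 : 0 < p by rewrite powR_gt0.
have q0 : 0 < q by rewrite powR_gt0.
have npq : n%:R = p * q.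
  by rewrite -powRD ?(gt_eqF N0) ?implybT//= -mulrDl -{1}[n%:R]powRr1 ?ler0n//; congr (_ `^ _); field.
have sqrt_le (z s : R) : u < `|z| -> 0 <= s -> s <= 4 * n%:R ->
    0 < Num.sqrt (z ^+ 2 + s) <= Num.sqrt (5 * n%:R) / u * `|z|.
  move=> uz s0 sn.
  have z0 : 0 < `|z| by exact: lt_trans uz.
  have z2 : 0 < z ^+ 2 by rewrite exprn_even_gt0 //= -normr_gt0.
  rewrite sqrtr_gt0 ltr_pwDl//=.
  have n5 : 0 <= 5 * n%:R :> R by rewrite mulr_ge0// ltW.
  rewrite -(ler_pXn2r (n := 2))// ?nnegrE ?sqrtr_ge0//; last first.
    by rewrite !mulr_ge0 ?sqrtr_ge0// invr_ge0 ltW.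
  rewrite !exprMn exprVn !sqr_sqrtr//; last by rewrite addr_ge0// ltW.
  rewrite real_normK ?num_real// [leRHS]mulrAC ler_pdivlMr ?exprn_gt0//.
  have uz2 : u ^+ 2 <= z ^+ 2.
    by rewrite -[z ^+ 2]real_normK ?num_real// lerXn2r ?nnegrE ?ltW.
  by have u2 := sqr_ge0 u; nra.
have /andP[S0 S1] := sqrt_le x v ux v0 vn.
have /andP[V0 V1] := sqrt_le y w uy w0 wn.
have SV : 0 < Num.sqrt (x ^+ 2 + v) * Num.sqrt (y ^+ 2 + w) by rewrite mulr_gt0.
rewrite mulrA ltr_pdivlMr//.
apply: (@le_lt_trans _ _ (a * (5 * n%:R / u ^+ 2 * `|x * y|))).
  rewrite ler_pM2l//.
  apply: le_trans (ler_pM (ltW S0) (ltW V0) S1 V1) _.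
  rewrite le_eqVlt; apply/orP; left; apply/eqP.
  rewrite -[in RHS](@sqr_sqrtr _ (5 * n%:R)) ?mulr_ge0 ?ltW// normrM.
  by field; rewrite gt_eqF.
rewrite uE npq.
have xy0 : 0 < `|x * y| by rewrite normrM mulr_gt0// (lt_trans u0).
rewrite mulrA ltr_pM2r//.
have -> : a * (5 * (p * q) / (6 * a * q)) = 5 / 6 * p.
  by field; rewrite !gt_eqF.
by nra.
Qed.

(** * The squared tail of X against the probability in the hypothesis *)

Lemma integral_sqr_eq_distribution d (T : measurableType d) (R : realType)
    (P : probability T R) (X Y : {RV P >-> R}) :
  (forall B, measurable B -> distribution P X B = distribution P Y B) ->
  (\int[P]_t ((X t) ^+ 2)%:E = \int[P]_t ((Y t) ^+ 2)%:E)%E.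
Proof.
move=> XY.
have msq : measurable_fun setT (fun y : R => (y ^+ 2)%:E).
  by apply/measurable_EFinP; exact: exprn_measurable.
have sq0 (y : R) : (0 <= (y ^+ 2)%:E)%E by rewrite lee_fin sqr_ge0.
rewrite -(@ge0_integral_distribution _ _ _ _ _ P X (fun y => (y ^+ 2)%:E))//.
rewrite -(@ge0_integral_distribution _ _ _ _ _ P Y (fun y => (y ^+ 2)%:E))//.
by apply: eq_measure_integral => B mB _; exact: XY.
Qed.

(** The squared tail is [P A], and the inequality [P A <= P E + P A / 2] is solved for the finite
    number [P A]. *)
Lemma tail_sqr_le d (T : measurableType d) (R : realType)
    (P : probability T R) (X : {RV P >-> R}) (Xa : nat -> nat -> {RV P >-> R})
    (a u : R) (n : nat) :
  iid_double_array X Xa -> ('E_P[fun t => ((X t) ^+ 2)%R] = 1)%E ->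
  0 < a -> (0 < n)%N -> 0 < u -> u ^+ 2 = 6 * a * n%:R `^ (3 / 4) ->
  u ^+ 2 <= n%:R ->
  fine (P [set t | u < `|X t|]) ^+ 2 <= 2 *
    fine (P [set t | n%:R `^ (1 / 4) *
                     (`|Xa 1%N 1%N t * Xa 1%N 2%N t| /
                      (Num.sqrt (\sum_(1 <= k < n.+1) (Xa k 1%N t) ^+ 2) *
                       Num.sqrt (\sum_(1 <= k < n.+1) (Xa k 2%N t) ^+ 2)))
                     > a]).
Proof.
move=> [indep ident] X2 a0 n0 u0 uE un; set E := [set t | (_ < n%:R `^ (1 / 4) * _)%R].
pose V := [set y : R | u < `|y|].
have mV : measurable V.
  rewrite -[V]setTI; apply: (measurable_fun_ltr _ (@normr_measurable _ _)) => //.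
have mX k i : measurable_fun [set: T] (Xa k i) by [].
have mX2 k i : measurable_fun [set: T] (fun t => (Xa k i t) ^+ 2) by exact: measurable_funX.
have inD k i : (1 <= k)%N -> (1 <= i)%N ->
    (None |` (Some @` [set ki : nat * nat | (1 <= ki.1)%N /\ (1 <= ki.2)%N]))
    (Some (k, i)) by move=> k1 i1; right; exists (k, i).
have dist k i B : (1 <= k)%N -> (1 <= i)%N -> measurable B ->
    P (Xa k i @^-1` B) = P (X @^-1` B).
  by move=> k1 i1 mB; exact: (ident (Some (k, i)) None (inD _ _ k1 i1) (or_introl erefl) B mB).
pose A := Xa 1%N 1%N @^-1` V `&` Xa 1%N 2%N @^-1` V.
have mA : measurable A.
  by apply: measurableI; rewrite -[X in measurable X]setTI; exact: mX.
have PA12 : (P A = P (Xa 1%N 1%N @^-1` V) * P (Xa 1%N 2%N @^-1` V))%E.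
  (* Pairwise independence, with the sure event attached to the third index [None]. *)
  have := mutually_independent3 (i := Some (1, 1)%N) (j := Some (1, 2)%N)
    (k := None) indep (inD _ _ _ _) (inD _ _ _ _) (or_introl erefl)
    isT isT isT mV mV measurableT.
  by rewrite preimage_setT setIT probability_setT mule1 => ->.
have indA k i B : (1 < k)%N -> (1 <= i)%N -> measurable B ->
    P (A `&` Xa k i @^-1` B) = (P A * P (Xa k i @^-1` B))%E.
  move=> k1 i1 mB; rewrite PA12 -muleA -setIA.
  apply: (mutually_independent3 (i := Some (1, 1)%N) (j := Some (1, 2)%N)
    (k := Some (k, i)) indep) => //; try exact: inD.
  - exact: (inD _ _ (ltnW k1) i1).
  - by apply/eqP => -[k1' _]; rewrite -k1' in k1.
  - by apply/eqP => -[k1' _]; rewrite -k1' in k1.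
have PA : P A = (P [set t | (u < `|X t|)%R] ^+ 2)%E.
  by rewrite PA12 !dist.
have intX k i : (1 < k)%N -> (1 <= i)%N -> (\int[P]_(t in A) ((Xa k i t) ^+ 2)%:E = P A)%E.
  move=> k1 i1.
  rewrite (@ge0_integral_indep_set _ _ _ P A (Xa k i) (fun y => (y ^+ 2)%:E))//.
  - rewrite (@integral_sqr_eq_distribution _ _ _ P (Xa k i) X).
      by rewrite unlock in X2; rewrite X2 mule1.
    by move=> B mB; exact: dist (ltnW k1) i1 mB.
  - by move=> B mB; exact: indA.
  - by apply/measurable_EFinP; exact: exprn_measurable.
  - by move=> y; rewrite lee_fin sqr_ge0.
(* Row 1 is left out because its entries define [A]. *)
pose W t := \sum_(2 <= k < n.+1) ((Xa k 1%N t) ^+ 2 + (Xa k 2%N t) ^+ 2).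
have mW : measurable_fun [set: T] W.
  by apply: measurable_sum => k; exact: measurable_funD.
have W0 t : 0 <= W t by apply: sumr_ge0 => k _; rewrite addr_ge0 ?sqr_ge0.
(* The exact factor [2 (n - 1)] is rounded up to [2 n]; the absolute value fits the form of Markov's
   inequality applied below. *)
have intW : (\int[P]_(t in A) `|(W t)%:E| <= (2 * n%:R)%:E * P A)%E.
  under eq_integral do rewrite gee0_abs ?lee_fin// /W -sumEFin.
  rewrite ge0_integral_sum//; last 2 first.
  - by move=> k; apply/measurable_EFinP; apply: measurable_funTS; exact: measurable_funD.
  - by move=> k t _; rewrite lee_fin addr_ge0 ?sqr_ge0.
  rewrite big_nat_cond (eq_bigr (fun=> (2%:E * P A)%E)); last first.
    move=> k /andP[/andP[k1 _] _]; under eq_integral do rewrite EFinD.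
    rewrite ge0_integralD//; last 4 first.
    - by move=> t _; rewrite lee_fin sqr_ge0.
    - by apply/measurable_EFinP; exact: measurable_funTS.
    - by move=> t _; rewrite lee_fin sqr_ge0.
    - by apply/measurable_EFinP; exact: measurable_funTS.
    by rewrite !intX// -[P A]fineK ?fin_num_measure// -EFinD -EFinM mulr_natl.
  rewrite -big_nat_cond -[P A]fineK ?fin_num_measure// -!EFinM sumEFin lee_fin.
  rewrite sumr_const_nat subSS -[leLHS]mulr_natr [leLHS]mulrAC ler_wpM2r ?fine_ge0//.
  by rewrite ler_pM2l// ler_nat leq_subr.
pose G := [set t | 4 * n%:R <= W t].
have mG : measurable G.
  by rewrite -[G]setTI; exact: (measurable_fun_ler _ mW).
have mE : measurable E.
  rewrite -[E]setTI; apply: measurable_fun_ltr => //.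
  apply: measurable_funM => //; apply: measurable_funM.
    by apply: measurableT_comp; [exact: normr_measurable|exact: measurable_funM].
  have msqrt i : measurable_fun [set: T]
      (fun t => Num.sqrt (\sum_(1 <= k < n.+1) (Xa k i t) ^+ 2)).
    apply: (measurableT_comp (continuous_measurable_fun (@sqrt_continuous R))).
    by apply: measurable_sum => k.
  (* The inverse becomes the power of exponent -1, a measurable function; the two agree at 0 as
     well, where both are 0. *)
  under eq_fun do rewrite -powR_inv1 ?mulr_ge0 ?sqrtr_ge0//.
  apply: (measurableT_comp (measurable_powR _)).
  exact: measurable_funM.
have PG : (P (A `&` G) <= 2^-1%:E * P A)%E.
  have n4 : 0 < 4 * n%:R :> R by rewrite mulr_gt0 ?ltr0n.
  have mWA : measurable_fun A (fun t => (W t)%:E).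
    by apply/measurable_EFinP; exact: measurable_funTS.
  have AG : A `&` G = A `&` [set t | ((4 * n%:R)%:E <= `|(W t)%:E|)%E].
    by apply/seteqP; split=> t [At]; rewrite /G /= lee_fin ger0_norm.
  have : ((4 * n%:R)%:E * P (A `&` G) <= (2 * n%:R)%:E * P A)%E.
    by rewrite AG; exact: le_trans (le_integral_abse P mA mWA n4) intW.
  rewrite -[P A]fineK ?fin_num_measure//.
  rewrite -[P (A `&` G)]fineK ?fin_num_measure//; last exact: measurableI.
  rewrite -!EFinM !lee_fin => H.
  by rewrite -(ler_pM2l n4); apply: le_trans H _; lra.
have sub : A `<=` E `|` (A `&` G).
  move=> t At.
  have [WG|WG] := leP (4 * n%:R) (W t); first by right; split.
  left; rewrite /E /=; case: At; rewrite /V /= => ux uy.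
  (* Splitting off row 1 writes each sum of squares as [x ^ 2 + v], where [v] is at most
     [W t < 4 n]. *)
  rewrite !(big_ltn (m := 1))// ?ltnS//.
  have W12 : W t = \sum_(2 <= k < n.+1) (Xa k 1%N t) ^+ 2 + \sum_(2 <= k < n.+1) (Xa k 2%N t) ^+ 2.
    exact: big_split.
  have S0 i : 0 <= \sum_(2 <= k < n.+1) (Xa k i t) ^+ 2.
    by apply: sumr_ge0 => k _; exact: sqr_ge0.
  apply: (@self_normalized_product_gt _ a u) => //; rewrite S0 /=.
    by have := S0 2%N; lra.
  by have := S0 1%N; lra.
have PAE : (P A <= P E + 2^-1%:E * P A)%E.
  apply: le_trans (_ : P (E `|` (A `&` G)) <= _)%E.
    apply: le_measure => //; rewrite inE//; apply: measurableU => //.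
    exact: measurableI.
  apply: le_trans (measureU2 _ mE (measurableI _ _ mA mG)) _.
  by rewrite leeD2l.
have mXV : measurable (X @^-1` V).
  by rewrite -[X in measurable X]setTI; exact: measurable_funPT.
rewrite -[_ ^+ 2](_ : fine (P A) = _); last by rewrite PA expe2 fineM ?fin_num_measure.
move: PAE; rewrite -[P A]fineK ?fin_num_measure// -[P E]fineK ?fin_num_measure//.
by rewrite -EFinM -EFinD lee_fin; lra.
Qed.

(** * Passage to dyadic n and summation *)

Theorem lemma2p7 (d : measure_display) (T : measurableType d) (R : realType)
    (P : probability T R) (X : {RV P >-> R}) (Xa : nat -> nat -> {RV P >-> R})
    (hiid : iid_double_array X Xa)
    (hX2 : ('E_P[fun t => ((X t) ^+ 2)%R] = 1)%E)
    (a : R) (ha : 0 < a)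
    (hO : (fun n : nat => n%:R ^+ 2 *
             fine (P [set t | n%:R `^ (1 / 4) *
                              (`|Xa 1%N 1%N t * Xa 1%N 2%N t| /
                               (Num.sqrt (\sum_(1 <= k < n.+1) (Xa k 1%N t) ^+ 2) *
                                Num.sqrt (\sum_(1 <= k < n.+1) (Xa k 2%N t) ^+ 2)))
                              > a])) =O_\oo (fun _ : nat => 1 : R)) :
  forall r : R, 0 < r < 8 / 3 -> ('E_P[fun t => (`|X t| `^ r)%R] < +oo)%E.
Proof.
move=> r /andP[r0 r83].
move/eqO_exP : hO => [k k0 [N _ hN]].
(* For [n = 2 ^ (j + N')] this ensures both [N <= n], where the O(1) bound holds, and
   [(6 a) ^ 4 <= n], which amounts to [u ^ 2 <= n]. *)
pose N' := maxn N (Num.bound ((6 * a) ^+ 4)).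
have pw n : 0 < (2 ^+ n : R) by rewrite exprn_gt0.
set b : R := 2 `^ (3 / 8).
have b1 : 1 < b by rewrite /b /powR gt_eqF// expR_gt1 mulr_gt0 ?ln_gt0//; lra.
have b0 : 0 < b by lra.
have c0 : 0 < Num.sqrt (6 * a) by rewrite sqrtr_gt0 mulr_gt0.
(* The level [c * b ^+ j] is then [u], the root of [6 a n ^ (3/4)], and [C * s ^+ j] is
   [sqrt (2 k) / n]; the factors with exponent [N'] account for the shift of index. *)
apply: (@moment_lty_geometric_tail _ _ _ P X (Num.sqrt (6 * a) * b ^+ N') b 2^-1
  (Num.sqrt (2 * k) / 2 ^+ N')) => //.
- by rewrite mulr_gt0// exprn_gt0.
(* The series converges when [2 ^ (3 r / 8) < 2], which is exactly [r < 8 / 3]. *)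
- rewrite -powRrM -ltr_pdivlMr ?invr_gt0// invrK mul1r -[ltRHS]powRr1//.
  rewrite /powR !gt_eqF// ltr_expR ltr_pM2r ?ln_gt0//; lra.
move=> j; set n := (2 ^ (j + N'))%N.
have nE : n%:R = 2 ^+ (j + N') :> R by rewrite natrX.
have n0 : (0 < n)%N by rewrite expn_gt0.
have Nn : (N <= n)%N.
  apply: (leq_trans (leq_maxl N (Num.bound ((6 * a) ^+ 4)))).
  by apply: (leq_trans (leq_addl j N')); rewrite ltnW// ltn_expl.
have powE (p : R) : n%:R `^ p = (2 `^ p) ^+ (j + N').
  by rewrite nE -!powR_mulrn ?powR_ge0// -!powRrM mulrC.
rewrite -mulrA -exprD addnC.
set u := Num.sqrt (6 * a) * b ^+ (j + N').
have u0 : 0 < u by rewrite mulr_gt0// exprn_gt0.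
have uE : u ^+ 2 = 6 * a * n%:R `^ (3 / 4).
  rewrite exprMn sqr_sqrtr; last by rewrite mulr_ge0// ltW.
  rewrite powE exprAC; congr (_ * _ ^+ _).
  by rewrite -powR_mulrn ?powR_ge0// -powRrM; congr (_ `^ _); field.
have un : u ^+ 2 <= n%:R.
  have npq : n%:R = n%:R `^ (1 / 4) * n%:R `^ (3 / 4) :> R.
    rewrite -powRD; last by rewrite gt_eqF ?ltr0n ?implybT.
    by rewrite -[LHS]powRr1//; congr (_ `^ _); field.
  rewrite uE [leRHS]npq.
  rewrite ler_wpM2r ?powR_ge0//.
  have a6 : 0 <= 6 * a by rewrite mulr_ge0// ltW.
  (* Written as a fourth root, [6 a] is compared with [n ^ (1/4)] through [(6 a) ^ 4 <= n]. *)
  have -> : 6 * a = ((6 * a) ^+ 4) `^ (1 / 4).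
    by rewrite -powR_mulrn// -powRrM (_ : 4 * (1 / 4) = 1) ?powRr1//; field.
  rewrite ge0_ler_powR ?nnegrE ?exprn_ge0// nE ltW// upper_nthrootP//.
  exact: leq_trans (leq_maxr N _) (leq_addl j N').
have tail2 := tail_sqr_le hiid hX2 ha n0 u0 uE un.
have := hN n Nn; rewrite /= normr1 mulr1.
set E := [set t | _ < _] in tail2 *; set F := [set t | _ < _] in tail2 *.
move=> hF.
have mE : measurable E.
  rewrite -[E]setTI; apply: (measurable_fun_ltr (f := cst u)) => //.
  by apply: measurableT_comp => //; exact: normr_measurable.
rewrite -[P E]fineK ?fin_num_measure// lee_fin exprVn -mulrA -invfM -exprD addnC -nE.
have nR : 0 < n%:R :> R by rewrite ltr0n.
rewrite ler_pdivlMr//.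
(* After squaring, the goal [P(E) ^ 2 * n ^ 2 <= 2 k] combines [P(E) ^ 2 <= 2 P(F)] with
   [n ^ 2 P(F) <= k]. *)
rewrite -(ler_pXn2r (n := 2)) ?nnegrE ?sqrtr_ge0 ?mulr_ge0 ?fine_ge0//.
rewrite sqr_sqrtr ?mulr_ge0 ?(ltW k0)// exprMn.
have := le_trans (ler_norm _) hF.
have : 0 < n%:R ^+ 2 :> R by rewrite exprn_gt0.
move: tail2; move: (fine (P E) ^+ 2) (fine (P F)) (n%:R ^+ 2) => e f n2; nra.
Qed.
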